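(* Let $G$ be an infinite residually finite group, and let $X$ be the (disjoint) union of the finite quotients of $G$, i.e. $X:=\bigsqcup_{N} G/N$ where $N$ ranges over all finite index normal subgroups of $G$. Let $G$ act on $X$ by right multiplication on each $G/N$; this action is faithful, so regard $G\leqslant \mathrm{Sym}(X)$ via it. Then the subgroup $\langle G,\mathrm{FAlt}(X)\rangle$ of $\mathrm{Sym}(X)$ has the $R_\infty$ property.
   Context: For a set $X$, $\mathrm{Sym}(X)$ is the group of all permutations of $X$ and $\mathrm{FAlt}(X)$ is the subgroup of even permutations with finite support. A group $G$ is residually finite if for each non-trivial $g\in G$ there are a finite group $F_g$ and a homomorphism $\phi_g:G\to F_g$ with $(g)\phi_g\neq 1$. For a group $H$ and $\phi\in\mathrm{Aut}(H)$ (maps written on the right), elements $a,b\in H$ are $\phi$-twisted conjugate if there is $x\in H$ with $(x^{-1})\phi\, a x=b$; the Reidemeister number $R(\phi)$ is the number of $\phi$-twisted conjugacy classes in $H$. $H$ has the $R_\infty$ property if $R(\phi)=\infty$ (infinitely many classes) for every $\phi\in\mathrm{Aut}(H)$. *)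

(* Defs.v *)
From HB Require Import structures.
From mathcomp Require Import all_boot fingroup.
From mathcomp Require Import boolp classical_sets functions cardinality.

Set Implicit Arguments.
Unset Strict Implicit.
Unset Printing Implicit Defensive.

Local Open Scope classical_set_scope.
Local Open Scope group_scope.

Record subgroup (G : groupType) := Subgroup {
  subgroup_set :> set G;
  subgroup_closed : group_closed (mem subgroup_set) }.

Definition subgroup_type (G : groupType) (H : subgroup G) : Type :=
  set_type (subgroup_set H).
Coercion subgroup_type : subgroup >-> Sortclass.

HB.instance Definition _ (G : groupType) (H : subgroup G) :=
  SubChoice.on (subgroup_type H).
HB.instance Definition _ (G : groupType) (H : subgroup G) :=
  SubChoice_isSubGroup.Build G _ (subgroup_type H) (subgroup_closed H).

Lemma subgroup_gen_closed (G : groupType) (A : set G) :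
  group_closed (mem (smallest (fun B : set G => group_closed (mem B)) A)).
Proof.
split; first by apply/mem_set => B [[B1 _] _]; exact: set_mem.
move=> x y /set_mem Ax /set_mem Ay; apply/mem_set => B BA.
have [[_ BV] _] := BA.
by apply: set_mem; apply: BV; apply/mem_set; [apply: Ax|apply: Ay].
Qed.

Definition subgroup_gen (G : groupType) (A : set G) : subgroup G :=
  Subgroup (subgroup_gen_closed A).

Definition normal_subgroup (G : groupType) (N : subgroup G) : Prop :=
  forall n x : G, n \in (N : set G) -> n ^ x \in (N : set G).

Definition right_coset (G : groupType) (N : set G) (x : G) : set G :=
  [set n * x | n in N].

Definition right_cosets (G : groupType) (N : set G) : set (set G) :=
  range (right_coset N).

Definition finite_index (G : groupType) (N : subgroup G) : Prop :=
  finite_set (right_cosets N).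

Definition residually_finite (G : groupType) : Prop :=
  forall g : G, g <> 1 ->
    exists (F : finGroupType) (phi : {multiplicative G -> F}), phi g <> 1.

Record Sym (X : Type) := MkSym {
  sym_fun :> X -> X;
  sym_inv : X -> X;
  sym_funK : cancel sym_fun sym_inv;
  sym_invK : cancel sym_inv sym_fun }.

HB.instance Definition _ (X : Type) := gen_eqMixin (Sym X).
HB.instance Definition _ (X : Type) := gen_choiceMixin (Sym X).

Lemma symP (X : Type) (s t : Sym X) : s =1 t -> s = t.
Proof.
case: s t => [f f' fK f'K] [g g' gK g'K] /= /funext fg; subst g.
have fg' : f' = g' by apply/funext => x; rewrite -{2}(f'K x) gK.
by subst g'; congr MkSym; exact: Prop_irrelevance.
Qed.

Section SymGroup.
Variable X : Type.
Implicit Types s t u : Sym X.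

Definition sym_one : Sym X :=
  @MkSym X id id (fun=> erefl) (fun=> erefl).

Definition sym_inverse s : Sym X := MkSym (sym_invK s) (sym_funK s).

(* Permutations act on the right: s * t is "first s, then t". *)
Definition sym_mul s t : Sym X :=
  MkSym (can_comp (sym_funK t) (sym_funK s))
        (can_comp (sym_invK s) (sym_invK t)).

Lemma sym_mulA : associative sym_mul.
Proof. by move=> s t u; exact: symP. Qed.
Lemma sym_mul1 : left_id sym_one sym_mul.
Proof. by move=> s; exact: symP. Qed.
Lemma sym_mulr1 : right_id sym_one sym_mul.
Proof. by move=> s; exact: symP. Qed.
Lemma sym_mulV : left_inverse sym_one sym_inverse sym_mul.
Proof. by move=> s; apply: symP => x /=; exact: sym_invK. Qed.
Lemma sym_mulrV : right_inverse sym_one sym_inverse sym_mul.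
Proof. by move=> s; apply: symP => x /=; exact: sym_funK. Qed.

HB.instance Definition _ := isGroup.Build (Sym X)
  sym_mulA sym_mul1 sym_mulr1 sym_mulV sym_mulrV.

Definition support s : set X := [set x | s x <> x].

Definition is_transposition s : Prop :=
  exists x y : X, [/\ x <> y, s x = y, s y = x &
    forall z, z <> x -> z <> y -> s z = z].

(* X may be infinite, so parity is stated through products of transpositions
   rather than with the sign of {perm T}. *)
Definition is_even s : Prop :=
  exists l : seq (Sym X), [/\ {in l, forall t, is_transposition t},
    ~~ odd (size l) & s = \prod_(t <- l) t].

Definition FAlt : set (Sym X) := [set s | finite_set (support s) /\ is_even s].

End SymGroup.

Definition fin_index_normal (G : groupType) : Type :=
  {N : subgroup G | normal_subgroup N /\ finite_index N}.

(* Tagging each coset with its subgroup N makes the union disjoint. *)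
Definition quotients_union (G : groupType) : Type :=
  {N : fin_index_normal G & set_type (right_cosets (sval N))}.

Section RightMul.
Variable G : groupType.
Implicit Types (N : fin_index_normal G) (g h : G).

Lemma rmul_subproof N (C : set_type (right_cosets (sval N))) g :
  [set c * g | c in val C] \in right_cosets (sval N).
Proof.
case: C => C /= /set_mem [x _ <-]; apply/mem_set; exists (x * g) => //.
by rewrite /right_coset image_comp; apply: eq_imagel => n _ /=; rewrite mulgA.
Qed.

Definition rmul g (p : quotients_union G) : quotients_union G :=
  let: existT N C := p in
  existT (fun N => set_type (right_cosets (sval N))) N
    (exist (fun C => C \in right_cosets (sval N)) _ (rmul_subproof C g)).

Lemma rmulM g h p : rmul h (rmul g p) = rmul (g * h) p.
Proof.
case: p => N C; rewrite /rmul /=; congr existT; apply/val_inj => /=.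
by rewrite image_comp; apply: eq_imagel => c _ /=; rewrite mulgA.
Qed.

Lemma rmul1 p : rmul 1 p = p.
Proof.
case: p => N C; rewrite /rmul /=; congr existT; apply/val_inj => /=.
by rewrite -[RHS]image_id; apply: eq_imagel => c _ /=; rewrite mulg1.
Qed.

Lemma rmulK g : cancel (rmul g) (rmul g^-1).
Proof. by move=> p; rewrite rmulM mulgV rmul1. Qed.
Lemma rmulVK g : cancel (rmul g^-1) (rmul g).
Proof. by move=> p; rewrite rmulM mulVg rmul1. Qed.

Definition right_action g : Sym (quotients_union G) :=
  MkSym (rmulK g) (rmulVK g).

Lemma right_actionM : {morph right_action : g h / g * h}.
Proof. by move=> g h; apply: symP => p; exact/esym/rmulM. Qed.

HB.instance Definition _ :=
  isMultiplicative.Build G (Sym (quotients_union G)) right_action right_actionM.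

End RightMul.

Lemma right_action_inj (G : groupType) :
  residually_finite G -> injective (@right_action G).
Proof.
move=> rfG g h gh; apply: contrapT => gNh.
have [|F [phi phi1]] := rfG (g / h).
  by move=> gh1; apply: gNh; rewrite -[g](mulgVK h) gh1 mul1g.
have phi_1 : phi 1 = 1 by apply: (mulgI (phi 1)); rewrite -gmulfM !mulg1.
have phiV x : phi x^-1 = (phi x)^-1.
  by apply: (mulgI (phi x)); rewrite -gmulfM !mulgV.
have Kcl : group_closed (mem [set x | phi x = 1]).
  split; first by apply/mem_set.
  move=> x y /set_mem /= x1 /set_mem /= y1; apply/mem_set => /=.
  by rewrite gmulfM phiV x1 y1 invg1 mulg1.
pose K := Subgroup Kcl.
have Kn : normal_subgroup K.
  move=> n x /set_mem /= n1; apply/mem_set => /=.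
  by rewrite /conjg !gmulfM phiV n1 mul1g mulVg.
have Kf : finite_index K.
  apply: (@sub_finite_set _ _ [set phi @^-1` [set f] | f in [set: F]]).
    move=> _ [x _ <-]; exists (phi x) => //; apply/seteqP; split=> y /=.
      move=> yx; exists (y / x); last by rewrite mulgVK.
      by rewrite /K /= gmulfM phiV yx mulgV.
    by move=> [n n1 <-]; rewrite gmulfM n1 mul1g.
  by apply: finite_image; exact: finite_finset.
pose N : fin_index_normal G := exist _ K (conj Kn Kf).
have C1 : right_coset K 1 \in right_cosets K by apply/mem_set; exists 1.
pose p : quotients_union G :=
  existT (fun N : fin_index_normal G => set_type (right_cosets (sval N))) N
    (exist (fun C => C \in right_cosets (sval N)) _ C1).
have /(congr1 (fun q : quotients_union G => val (projT2 q))) /= :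
  right_action g p = right_action h p by rewrite gh.
move=> /seteqP[/(_ g) sub _]; case: sub => [|_ [n n1 <-] /= E].
  by exists 1; [exists 1; rewrite ?mulg1|rewrite mul1g].
by apply: phi1; rewrite -E mulg1 mulgK.
Qed.

Section Reidemeister.
Variables (H : groupType) (phi : H -> H).

(* Written on the right, (x^-1)phi is phi x^-1. *)
Definition twisted_conj (a b : H) : Prop := exists x, phi x^-1 * a * x = b.

Definition twisted_class (a : H) : set H := [set b | twisted_conj a b].

Definition Reidemeister_infinite : Prop :=
  infinite_set (range twisted_class).

End Reidemeister.

Definition R_infinity (H : groupType) : Prop :=
  forall phi : {multiplicative H -> H}, bijective phi ->
    Reidemeister_infinite phi.

(* Main.v *)
Require Import Defs.
From HB Require Import structures.
From mathcomp Require Import all_boot.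
From mathcomp Require Import boolp classical_sets functions cardinality.

(** The theorem holds for every group H of permutations of an infinite set X
    that contains FAlt(X) and all of whose elements have only finite cycles
    ([R_infinity_of_finite_cycles]).

    Every automorphism phi of such an H is conjugation by some rho in Sym(X)
    ([automorphism_inner]). Hence phi(x^-1) a x = b means that rho a and rho b
    are conjugate by x, and the phi-twisted classes of H are the
    H-conjugacy classes in the coset rho H. If x has only finite cycles, then
    conjugation by x cannot take a permutation to one with a strictly smaller
    support ([support_conj_sub]): it would map the larger support into the
    smaller one, and a point lost in this way would reappear further along its
    own cycle. So a sequence a_0, a_1, ... in H for which the supports of the
    rho a_n are strictly monotone gives infinitely many classes. Multiplying
    by one suitable 3-cycle strictly shrinks an infinite support
    ([support_shrink]) and strictly enlarges a support with infinite complement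
    ([support_grow]); one of these two steps can be repeated for ever.

    To find rho, one recognises 3-cycles inside H by a condition that
    automorphisms preserve: c has order 3 and (c c^h)^30 = 1 for all h. The
    product of two 3-cycles has order 1, 2, 3 or 5, whereas an element of order
    3 with a second cycle has a conjugate for which the product has a cycle
    of length 7 or 9 ([exponent30_is_cycle3]). The 3-cycles (a b z), for fixed
    a, b and varying z, have pairwise products of order 2. Their images are
    3-cycles with the same property, which forces them to have the form
    (p q z'), and rho maps z to z'. All 3-cycles arise from the (a b z) by
    conjugation, and H acts faithfully by conjugation on 3-cycles.

    Finally, an element of <G, FAlt(X)> permutes the points of each block G/N,
    except for finitely many N; since blocks are finite, its cycles are finite
    ([finite_cycles]). The union X is infinite because G acts faithfully. *)

Set Implicit Arguments.
Unset Strict Implicit.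
Unset Printing Implicit Defensive.

Local Open Scope classical_set_scope.
Local Open Scope group_scope.

(** * Permutations and 3-cycles *)

Section SymTheory.
Variable X : Type.
Implicit Types (p : X) (s t : Sym X).

Lemma symM s t p : (s * t) p = t (s p). Proof. by []. Qed.

Lemma sym_eq1 s : s =1 id -> s = 1.
Proof. by move=> s1; apply: symP => p; rewrite s1. Qed.

Lemma symKV s : cancel s (s^-1)%g. Proof. exact: sym_funK. Qed.

Lemma symVK s : cancel (s^-1)%g s. Proof. exact: sym_invK. Qed.

Lemma symJ s t p : (s ^ t) (t p) = t (s p).
Proof. by rewrite conjgE !symM symKV. Qed.

Lemma symX s n p : (s ^+ n) p = iter n s p.
Proof. by elim: n p => // n IHn p; rewrite expgSr symM IHn. Qed.

End SymTheory.

Section Cycle3.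
Variable X : eqType.
Implicit Types (x y z p : X) (s t c : Sym X).

Definition swap x y p := if p == x then y else if p == y then x else p.

Lemma swapK x y : involutive (swap x y).
Proof.
move=> p; rewrite /swap; case: (eqVneq p x) => [->|px].
  by case: (eqVneq y x) => // _; rewrite eqxx.
by case: (eqVneq p y) => [->|py]; rewrite ?eqxx // (negPf px) (negPf py).
Qed.

Definition transp x y : Sym X := MkSym (swapK x y) (swapK x y).

(** The value 1 on repeated points makes conjugation, rotation and membership
    in FAlt(X) hold for all triples. *)
Definition cycle3 x y z : Sym X :=
  if uniq [:: x; y; z] then transp x y * transp x z else 1.

Arguments cycle3 : simpl never.

Definition rot3 (T : eqType) (x y z p : T) :=
  if p == x then y else if p == y then z else if p == z then x else p.

Lemma cycle3E x y z : uniq [:: x; y; z] -> cycle3 x y z =1 rot3 x y z.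
Proof.
rewrite /cycle3 => xyz; rewrite xyz; move: xyz.
rewrite /= !inE negb_or andbT => /andP[/andP[xy xz] yz] p.
rewrite /swap /rot3 /=.
case: (eqVneq p x) => [_|px].
  by rewrite eq_sym (negPf xy) (negPf yz).
case: (eqVneq p y) => [_|py]; first by rewrite eqxx.
by rewrite (negPf px).
Qed.

Lemma cycle3_degenerate x y z : ~~ uniq [:: x; y; z] -> cycle3 x y z = 1.
Proof. by rewrite /cycle3 => /negPf->. Qed.

Lemma transpJ x y s : transp x y ^ s = transp (s x) (s y).
Proof.
apply: symP => p; rewrite -[p](symVK s) symJ /= /swap.
by rewrite !(inj_eq (can_inj (symKV s))); case: eqP => // _; case: eqP.
Qed.

Lemma cycle3J x y z s : cycle3 x y z ^ s = cycle3 (s x) (s y) (s z).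
Proof.
rewrite /cycle3 -[[:: s x; s y; s z]]/(map s [:: x; y; z]).
rewrite map_inj_uniq; last exact: can_inj (symKV s).
by case: uniq; rewrite ?conj1g // conjMg !transpJ.
Qed.

Lemma cycle3_rot x y z : cycle3 x y z = cycle3 y z x.
Proof.
have E : uniq [:: y; z; x] = uniq [:: x; y; z].
  by rewrite -(rot_uniq 1 [:: x; y; z]).
case: (boolP (uniq [:: x; y; z])) => U; last first.
  by rewrite /cycle3 E (negPf U).
apply: symP => p; rewrite !cycle3E ?E // /rot3; move: U => /=.
rewrite !inE negb_or andbT => /andP[/andP[xy xz] yz].
case: (eqVneq p x) => [->|_]; last first.
  by case: (p == y); case: (p == z).
by rewrite (negPf xy) (negPf xz).
Qed.

Lemma cycle3V x y z : (cycle3 x y z)^-1 = cycle3 y x z.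
Proof.
have E : uniq [:: y; x; z] = uniq [:: x; y; z].
  by apply/perm_uniq/permPl; apply: (perm_catCA [:: y] [:: x] [:: z]).
case: (boolP (uniq [:: x; y; z])) => U; last first.
  by rewrite /cycle3 E (negPf U) invg1.
apply: (mulgI (cycle3 x y z)); rewrite mulgV; apply: symP => p.
rewrite symM !cycle3E ?E // /rot3; move: U => /=.
rewrite !inE negb_or andbT => /andP[/andP[xy xz] yz].
case: (eqVneq p x) => [->|px]; first by rewrite eqxx.
case: (eqVneq p y) => [->|py].
  by rewrite ![z == _]eq_sym (negPf yz) (negPf xz) eqxx.
case: (eqVneq p z) => [->|pz].
  by rewrite (negPf xy) eqxx.
by rewrite (negPf px) (negPf py) (negPf pz).
Qed.

Lemma cycle3_FAlt x y z : FAlt (cycle3 x y z).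
Proof.
case: (boolP (uniq [:: x; y; z])) => U; last first.
  rewrite /cycle3 (negPf U); split.
    by rewrite (_ : Defs.support _ = set0) //; apply/seteqP; split.
  by exists [::]; rewrite big_nil.
split.
  apply: (sub_finite_set _ (finite_set3 x y z)) => p /=.
  rewrite /Defs.support /mkset cycle3E // /rot3.
  by do 3![case: eqP => [->|_]; [tauto|]].
rewrite /cycle3 U; move: U => /=; rewrite !inE negb_or andbT.
move=> /andP[/andP[/eqP xy /eqP xz] _].
have tr a b : a <> b -> is_transposition (transp a b).
  move=> ab; exists a, b; rewrite /= /swap !eqxx; split=> //.
    by case: eqP => // <-.
  by move=> w; case: eqP => // _; case: eqP.
exists [:: transp x y; transp x z]; split=> //; last first.
  by rewrite !big_cons big_nil mulg1.
by move=> t; rewrite !inE => /orP[] /eqP ->; exact: tr.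
Qed.

End Cycle3.

(** * Products of 3-cycles, computed on labels *)

Section Labels.
Variables (X : eqType) (e : nat -> X) (n : nat).
Hypothesis e_inj : {in gtn n &, injective e}.
Implicit Types (s t : Sym X) (m r : nat -> nat).

(** The points [e 0], ..., [e n.-1] carry the labels [0], ..., [n.-1]; the
    function [m] describes [s] on labels, so that identities between
    permutations become computations with natural numbers. *)
Definition follows s m := forall i, i < n -> m i < n /\ s (e i) = e (m i).

Lemma followsM s t m r :
  follows s m -> follows t r -> follows (s * t) (r \o m).
Proof.
move=> sm tm i /sm[mi sE]; have [ri tE] := tm _ mi.
by rewrite symM sE tE.
Qed.

Lemma followsX s m q : follows s m -> follows (s ^+ q) (iter q m).
Proof.
move=> sm i ltin; rewrite symX.
elim: q => //= q [ltr ->]; exact: sm.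
Qed.

Lemma follows_cycle3 i j k : uniq [:: i; j; k] -> i < n -> j < n -> k < n ->
  follows (cycle3 (e i) (e j) (e k)) (rot3 i j k).
Proof.
move=> U ltin ltjn ltkn l ltln.
have eE a b : a < n -> b < n -> (e a == e b) = (a == b).
  by move=> an bn; apply/eqP/eqP => [/e_inj->|->].
have U' : uniq [:: e i; e j; e k].
  by move: U; rewrite /= !inE (eE i j) // (eE i k) // (eE j k).
split; first by rewrite /rot3; do ?case: ifP.
by rewrite cycle3E // /rot3 (eE l i) // (eE l j) // (eE l k) //; do ?case: ifP.
Qed.

End Labels.

Definition involutive_product (K : groupType) (c d : K) :=
  (c * d) ^+ 2 = 1 /\ c * d <> 1.

Section Labelling.
Variable X : eqType.

(** The first labels enumerate [s1] in order; the points of [s2] may coincide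
    with each other and with those of [s1], which is why their labels are
    only known to exist. *)
Lemma labelling x (s1 s2 : seq X) : uniq s1 -> exists e : nat -> X, exists n,
  [/\ n <= size s1 + size s2, {in gtn n &, injective e},
      forall i, i < size s1 -> e i = nth x s1 i /\ i < n
    & forall p, p \in s2 -> exists2 i, i < n & e i = p].
Proof.
move=> U1; pose s := s1 ++ undup [seq p <- s2 | p \notin s1].
have U : uniq s.
  rewrite cat_uniq U1 undup_uniq andbT /=; apply/hasPn => p.
  by rewrite mem_undup mem_filter => /andP[].
exists (nth x s), (size s); split.
- rewrite size_cat leq_add2l; apply: leq_trans (size_undup _) _.
  by rewrite size_filter count_size.
- by move=> i j /= si sj /eqP; rewrite nth_uniq // => /eqP.
- by move=> i ltis; rewrite nth_cat ltis size_cat ltn_addr.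
- move=> p ps2; have ps : p \in s.
    by rewrite mem_cat mem_undup mem_filter ps2 andbT orbN.
  by exists (index p s); rewrite ?index_mem ?nth_index.
Qed.

Lemma labelling_cycle x (s : seq X) u v w p : uniq s -> uniq [:: u; v; w] ->
  exists e : nat -> X, exists n, exists i, exists j, exists k, exists l,
  [/\ n <= size s + 4 /\ {in gtn n &, injective e},
      forall a, a < size s -> e a = nth x s a /\ a < n,
      [/\ i < n, j < n, k < n & l < n], uniq [:: i; j; k]
    & [/\ e i = u, e j = v, e k = w & e l = p]].
Proof.
move=> Us Uuvw.
have [e [n [le_n e_inj e1 e2]]] := labelling x [:: u; v; w; p] Us.
have [|i lti Eu] := e2 u; first by rewrite !inE eqxx.
have [|j ltj Ev] := e2 v; first by rewrite !inE eqxx ?orbT.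
have [|k ltk Ew] := e2 w; first by rewrite !inE eqxx ?orbT.
have [|l ltl Ep] := e2 p; first by rewrite !inE eqxx ?orbT.
exists e, n, i, j, k, l; split=> //.
by apply: (@map_uniq _ _ e); rewrite /= Eu Ev Ew.
Qed.

(** A check over the labels [i], [j], [k] of a 3-cycle in arbitrary position and
    the label [l] of one further point. *)
Definition table n (P : nat -> nat -> nat -> nat -> bool) :=
  all (fun i => all (fun j => all (fun k => uniq [:: i; j; k] ==>
    all (P i j k) (iota 0 n)) (iota 0 n)) (iota 0 n)) (iota 0 n).

Lemma tableP n P : table n P -> forall m i j k l, m <= n ->
  [/\ i < m, j < m, k < m & l < m] -> uniq [:: i; j; k] -> P i j k l.
Proof.
move=> tP m i j k l le_mn [im jm km lm] U.
have mem a : a < m -> a \in iota 0 n.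
  by rewrite mem_iota => /leq_trans; exact.
move: tP => /allP/(_ i (mem _ im))/allP/(_ j (mem _ jm))/allP/(_ k (mem _ km)).
by move=> /implyP/(_ U)/allP; apply; exact: mem.
Qed.

(** Depending on the number of common points, the product of two 3-cycles has
    order 1, 2, 3 or 5. The overlaps are enumerated by computation: six points
    and one test point need at most seven labels. *)
Lemma cycle3_prod_order (x y z u v w : X) :
    uniq [:: x; y; z] -> uniq [:: u; v; w] ->
  (cycle3 x y z * cycle3 u v w) ^+ 30 = 1.
Proof.
move=> Uxyz Uuvw; apply: sym_eq1 => p.
have := labelling_cycle x p Uxyz Uuvw.
move=> [e [n [i [j [k [l [[le_n e_inj] e1 lt_n Uijk [Eu Ev Ew Ep]]]]]]]].
have [Ex lt0] : e 0 = x /\ 0 < n by exact: e1.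
have [Ey lt1] : e 1%N = y /\ 1%N < n by exact: e1.
have [Ez lt2] : e 2 = z /\ 2 < n by exact: e1.
have [lti ltj ltk ltl] := lt_n.
have F : follows e n (cycle3 x y z * cycle3 u v w) (rot3 i j k \o rot3 0 1%N 2).
  apply: followsM; rewrite -?Ex -?Ey -?Ez -?Eu -?Ev -?Ew;
    exact: (follows_cycle3 e_inj).
have [_] := followsX 30 F ltl; rewrite Ep => ->; rewrite -Ep; congr e.
have T : table 7 (fun i j k l =>
  iter 30 (rot3 i j k \o rot3 0 1%N 2) l == l) by vm_compute.
by apply/eqP; exact: (tableP T le_n).
Qed.

Lemma neq1_moves (s : Sym X) : s <> 1 -> exists p, s p <> p.
Proof.
move=> s1; apply: contrapT => /forallNP E; apply/s1/sym_eq1 => p.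
exact: contrapT.
Qed.

Definition is_cycle3 (c : Sym X) :=
  exists x y z, uniq [:: x; y; z] /\ c = cycle3 x y z.

Lemma is_cycle3_at c p : is_cycle3 c -> c p <> p ->
  uniq [:: p; c p; c (c p)] /\ c = cycle3 p (c p) (c (c p)).
Proof.
move=> [x [y [z [U ->]]]].
have aux (a b d : X) : uniq [:: a; b; d] ->
    cycle3 a b d a = b /\ cycle3 a b d b = d.
  move=> Ua; rewrite !cycle3E // /rot3 !eqxx; split=> //.
  by move: Ua; rewrite /= !inE negb_or eq_sym => /andP[/andP[/negPf->]].
have [Ex Ey] := aux x y z U.
have U1 : uniq [:: y; z; x] by rewrite -(rot_uniq 1 [:: x; y; z]) in U.
have U2 : uniq [:: z; x; y] by rewrite -(rot_uniq 2 [:: x; y; z]) in U.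
have [_ Ez] := aux y z x U1; rewrite -cycle3_rot in Ez.
rewrite {1}cycle3E // /rot3.
case: eqP => [->|_]; first by rewrite Ex Ey.
case: eqP => [->|_]; first by rewrite Ey Ez -(cycle3_rot x).
by case: eqP => [->|_] //; rewrite Ez Ex (cycle3_rot z).
Qed.

(** Two 3-cycles whose product has order 2 are of the form (p q r), (p q s) with
    r <> s: the other overlaps give order 1, 3 or 5. *)
Lemma cycle3_common_edge c d : is_cycle3 c -> is_cycle3 d ->
  involutive_product c d ->
  exists p, [/\ c p <> p, d p = c p & d (c p) <> c (c p)].
Proof.
move=> [x [y [z [Uxyz ->]]]] [u [v [w [Uuvw ->]]]] [sq /neq1_moves[a moves_a]].
have := labelling_cycle x a Uxyz Uuvw.
move=> [e [n [i [j [k [l [[le_n e_inj] e1 lt_n Uijk [Eu Ev Ew El]]]]]]]].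
have [Ex lt0] : e 0 = x /\ 0 < n by exact: e1.
have [Ey lt1] : e 1%N = y /\ 1 < n by exact: e1.
have [Ez lt2] : e 2 = z /\ 2 < n by exact: e1.
have [lti ltj ltk ltl] := lt_n.
pose m := rot3 0 1%N 2; pose r := rot3 i j k.
have Fm : follows e n (cycle3 x y z) m.
  by rewrite -Ex -Ey -Ez; exact: (follows_cycle3 e_inj).
have Fr : follows e n (cycle3 u v w) r.
  by rewrite -Eu -Ev -Ew; exact: (follows_cycle3 e_inj).
have F := followsM Fm Fr.
have F2 b : b < n -> iter 2 (r \o m) b == b.
  move=> ltb; have [lt' E] := followsX 2 F ltb.
  by apply/eqP; apply: e_inj => //; rewrite -E sq.
have Fl : (r \o m) l != l.
  have [_ E] := F l ltl.
  by apply/eqP => E'; rewrite E' El in E; exact: moves_a.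
have T : table 7 (fun i j k l => let m := rot3 0 1%N 2 in let r := rot3 i j k in
    all (fun b => iter 2 (r \o m) b == b) [:: 0; 1%N; 2; i; j; k] &&
    ((r \o m) l != l) ==>
    has (fun b => (r b == m b) && (r (m b) != m (m b))) [:: 0; 1%N; 2]).
  by vm_compute.
have /implyP H := tableP T le_n lt_n Uijk.
have /hasP[b b_in /andP[/eqP rm /eqP rmm]] :
    has (fun b => (r b == m b) && (r (m b) != m (m b))) [:: 0; 1%N; 2].
  apply: H; rewrite Fl andbT; apply/allP => b b_in; apply: F2.
  have lt_all : all (gtn n) [:: 0; 1%N; 2; i; j; k].
    by rewrite /= lt0 lt1 lt2 lti ltj ltk.
  exact: (allP lt_all).
have lt_all : all (gtn n) [:: 0; 1%N; 2] by rewrite /= lt0 lt1 lt2.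
have bn : b < n by exact: (allP lt_all).
have mb : m b != b by apply: (@allP _ (fun b => m b != b) [:: 0; 1%N; 2]).
have [mbn Emb] := Fm b bn; have [_ Emmb] := Fm _ mbn.
have [_ Erb] := Fr b bn; have [rmbn Ermb] := Fr _ mbn.
exists (e b); rewrite Emb Erb rm Emmb Ermb; split=> //.
  by move=> /(e_inj _ _ mbn bn)/eqP; rewrite (negPf mb).
by move=> /(e_inj _ _ rmbn (proj1 (Fm _ mbn))).
Qed.

(** A third 3-cycle [f] must share an oriented edge with (p q r) and with
    (p q s). If this is not p -> q for both, then [f] contains q -> r or r -> p
    as well as q -> s or s -> p, which is impossible for a 3-cycle. *)
Lemma cycle3_edge_determined c d f p :
    is_cycle3 c -> is_cycle3 d -> is_cycle3 f ->
    c p <> p -> d p = c p -> d (c p) <> c (c p) ->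
    involutive_product c f -> involutive_product d f ->
  f p = c p.
Proof.
move=> c3 d3 [u [v [w [Uuvw ->]]]] cp dp dcp [cf2 cf1] [df2 _].
have [Uc Ec] := is_cycle3_at c3 cp.
have [|Ud Ed] := is_cycle3_at d3 (p := p); first by rewrite dp.
rewrite dp in Ud Ed.
set q := c p in Uc Ec Ud Ed dcp *; set r := c q in Uc Ec dcp.
set s := d q in Ud Ed dcp.
have U4 : uniq [:: p; q; r; s].
  move: Uc Ud; rewrite /= !inE !negb_or !andbT.
  move=> /andP[/andP[-> ->] ->] /andP[/andP[_ ->] ->].
  by rewrite eq_sym; move/eqP: dcp => ->.
move/neq1_moves: cf1 => [a moves_a].
have := labelling_cycle p a U4 Uuvw.
move=> [e [n [i [j [k [l [[le_n e_inj] e1 lt_n Uijk [Eu Ev Ew El]]]]]]]].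
have [Ep lt0] : e 0 = p /\ 0 < n by exact: e1.
have [Eq lt1] : e 1%N = q /\ 1 < n by exact: e1.
have [Er lt2] : e 2 = r /\ 2 < n by exact: e1.
have [Es lt3] : e 3 = s /\ 3 < n by exact: e1.
have [lti ltj ltk ltl] := lt_n.
have Ff : follows e n (cycle3 u v w) (rot3 i j k).
  by rewrite -Eu -Ev -Ew; exact: (follows_cycle3 e_inj).
have Fc : follows e n c (rot3 0 1%N 2).
  by rewrite Ec -Ep -Eq -Er; exact: (follows_cycle3 e_inj).
have Fd : follows e n d (rot3 0 1%N 3).
  by rewrite Ed -Ep -Eq -Es; exact: (follows_cycle3 e_inj).
have F2 t m b : follows e n t m -> (t * cycle3 u v w) ^+ 2 = 1 -> b < n ->
    iter 2 (rot3 i j k \o m) b == b.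
  move=> Ft t2 ltb; have [lt' E] := followsX 2 (followsM Ft Ff) ltb.
  by apply/eqP; apply: e_inj => //; rewrite -E t2.
have Fl : (rot3 i j k \o rot3 0 1%N 2) l != l.
  have [_ E] := followsM Fc Ff ltl.
  by apply/eqP => E'; rewrite E' El in E; exact: moves_a.
have T : table 8 (fun i j k l =>
    all (fun b => (iter 2 (rot3 i j k \o rot3 0 1%N 2) b == b) &&
                  (iter 2 (rot3 i j k \o rot3 0 1%N 3) b == b))
        [:: 0; 1%N; 2; 3; i; j; k] &&
    ((rot3 i j k \o rot3 0 1%N 2) l != l) ==> (rot3 i j k 0 == 1%N)).
  by vm_compute.
have /implyP H := tableP T le_n lt_n Uijk.
have /eqP r0 : rot3 i j k 0 == 1%N.
  apply: H; rewrite Fl andbT; apply/allP => b b_in.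
  have ltb : b < n.
    have lt_all : all (gtn n) [:: 0; 1%N; 2; 3; i; j; k].
      by rewrite /= lt0 lt1 lt2 lt3 lti ltj ltk.
    exact: (allP lt_all).
  by rewrite (F2 c) // (F2 d).
by have [_] := Ff 0 lt0; rewrite r0 Ep Eq.
Qed.

(** The product is the double transposition (p s)(q r). *)
Lemma cycle3_edge_involutive (p q r s : X) : uniq [:: p; q; r; s] ->
  involutive_product (cycle3 p q r) (cycle3 p q s).
Proof.
move=> U4.
have /and3P[Upqr Upqs ps] : [&& uniq [:: p; q; r], uniq [:: p; q; s] & s != p].
  move: U4; rewrite /= !inE !negb_or !andbT.
  move=> /and3P[/and3P[-> -> ps] /andP[-> ->] _].
  by rewrite ps eq_sym ps.
split; last first.
  move=> /(congr1 (fun t : Sym X => t p)); rewrite symM.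
  have -> : cycle3 p q r p = q by rewrite cycle3E // /rot3 eqxx.
  rewrite cycle3E // /rot3 eqxx /=; case: eqP => [qp|_]; last by move/eqP: ps.
  by move: Upqr; rewrite qp /= inE eqxx.
apply: sym_eq1 => a; have := labelling_cycle p a U4 Upqr.
move=> [e [n [i [j [k [l [[le_n e_inj] e1 [_ _ _ ltl] _ [_ _ _ El]]]]]]]].
have [Ep lt0] : e 0 = p /\ 0 < n by exact: e1.
have [Eq lt1] : e 1%N = q /\ 1 < n by exact: e1.
have [Er lt2] : e 2 = r /\ 2 < n by exact: e1.
have [Es lt3] : e 3 = s /\ 3 < n by exact: e1.
have F : follows e n (cycle3 p q r * cycle3 p q s)
    (rot3 0 1%N 3 \o rot3 0 1%N 2).
  by apply: followsM; rewrite -Ep -Eq -?Er -?Es; exact: (follows_cycle3 e_inj).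
have [_] := followsX 2 F ltl; rewrite El => ->; rewrite -El; congr e.
have T : all (fun l => iter 2 (rot3 0 1%N 3 \o rot3 0 1%N 2) l == l) (iota 0 8).
  by vm_compute.
by apply/eqP; apply: (allP T); rewrite mem_iota; exact: leq_trans ltl le_n.
Qed.

Lemma is_cycle3_cube (c : Sym X) : is_cycle3 c -> c ^+ 3 = 1.
Proof.
move=> c3; apply: sym_eq1 => p; rewrite symX /=.
have [E|cp] := pselect (c p = p); first by rewrite !E.
have [U E] := is_cycle3_at c3 cp; rewrite {1}E cycle3E // /rot3.
move: U; rewrite /= !inE negb_or ![p == _]eq_sym.
move=> /and3P[/andP[_ /negPf->] ncc _].
by rewrite eqxx eq_sym (negPf ncc).
Qed.

Lemma is_cycle3_neq1 (c : Sym X) : is_cycle3 c -> c <> 1.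
Proof.
move=> [x [y [z [U ->]]]] /(congr1 (fun t : Sym X => t x)).
rewrite cycle3E // /rot3 eqxx => /= yx.
by move: U; rewrite yx /= inE eqxx.
Qed.

End Labelling.

(** * Recognising 3-cycles by group-theoretic conditions *)

Lemma infinite_avoid (X : eqType) (A : set X) (r : seq X) :
  infinite_set A -> exists2 p, A p & p \notin r.
Proof.
move=> A_inf; apply: contrapT => none; apply: A_inf.
apply: sub_finite_set (finite_seq r) => p Ap /=.
by apply: contraT => pr; case: none; exists p.
Qed.

Section Recognition.
Variable X : eqType.
Hypothesis X_inf : infinite_set [set: X].

Lemma fresh (s : seq X) : exists p, p \notin s.
Proof. by have [p _ ps] := infinite_avoid s X_inf; exists p. Qed.

Lemma orbit_extend (c : Sym X) (s : seq X) p : c ^+ 3 = 1 -> uniq s ->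
    {in s, forall q, c q \in s} -> p \notin s -> c p != p ->
  uniq (s ++ [:: p; c p; c (c p)]) /\
  {in s ++ [:: p; c p; c (c p)], forall q, c q \in s ++ [:: p; c p; c (c p)]}.
Proof.
move=> c3 Us s_closed ps cp.
have cK q : c (c (c q)) = q by rewrite -[RHS](_ : (c ^+ 3) q = q) // c3.
have notin q : q \notin s -> c q \notin s.
  by apply: contra => /s_closed/s_closed; rewrite cK.
split.
  have U3 : uniq [:: p; c p; c (c p)].
    have pc : p != c p by rewrite eq_sym.
    rewrite /= !inE !negb_or pc (can_eq (symKV c)) pc !andbT /=.
    by apply: contra cp => /eqP E; rewrite {1}E cK.
  rewrite cat_uniq Us U3 andbT; apply/hasPn => q.
  rewrite !inE => /or3P[] /eqP->; first exact: ps.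
    exact: notin ps.
  exact: notin (notin _ ps).
move=> q; rewrite !mem_cat => /orP[/s_closed->//|].
by rewrite !inE => /or3P[] /eqP->; rewrite ?cK eqxx ?orbT.
Qed.

(** The action on labels of c * c ^ h for h = (0 1 3)(0 1 6), when [m] is the
    action of c on labels. *)
Definition witness_labels (m : nat -> nat) : nat -> nat :=
  (rot3 0 1%N 6 \o rot3 0 1%N 3) \o m \o (rot3 1%N 0 3 \o rot3 1%N 0 6) \o m.

Lemma exponent30_fails (c : Sym X) e n m : {in gtn n &, injective e} -> 6 < n ->
    follows e n c m -> iter 30 (witness_labels m) 0 != 0 ->
  ~ (forall x y z u v w, (c * c ^ (cycle3 x y z * cycle3 u v w)) ^+ 30 = 1).
Proof.
move=> e_inj n6 Fc ne0 /(_ (e 0) (e 1%N) (e 3) (e 0) (e 1%N) (e 6)) E.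
have lt_n a : a < 7 -> a < n by move=> /leq_trans; apply.
have F i j k : uniq [:: i; j; k] -> i < 7 -> j < 7 -> k < 7 ->
    follows e n (cycle3 (e i) (e j) (e k)) (rot3 i j k).
  by move=> U i7 j7 k7; apply: (follows_cycle3 e_inj) => //; exact: lt_n.
have Fw : follows e n
    (c * c ^ (cycle3 (e 0) (e 1%N) (e 3) * cycle3 (e 0) (e 1%N) (e 6)))
    (witness_labels m).
  rewrite conjgE invgM !cycle3V.
  do !apply: followsM => //; exact: F.
have [lt' E'] := followsX 30 Fw (lt_n 0 isT).
by move/eqP: ne0; apply; apply: e_inj => //; [exact: lt_n|rewrite -E' E].
Qed.

(** An element of order 3 that is not a 3-cycle contains (0 1 2)(3 4 5), and
    there is a seventh point 6, either fixed or in a cycle (6 7 8). With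
    h = (0 1 3)(0 1 6), the point 0 lies in a cycle of c * c ^ h of length 7 in
    the first case and 9 in the second, neither of which divides 30. A point
    outside (0 1 2)(3 4 5) is needed: an outer automorphism of Alt(6) swaps
    the 3-cycles with the products of two disjoint 3-cycles. *)
Lemma exponent30_is_cycle3 (c : Sym X) : c ^+ 3 = 1 -> c <> 1 ->
  (forall x y z u v w, (c * c ^ (cycle3 x y z * cycle3 u v w)) ^+ 30 = 1) ->
  is_cycle3 c.
Proof.
move=> c3 /neq1_moves[p0 /eqP cp0] c30.
have cK q : c (c (c q)) = q by rewrite -[RHS](_ : (c ^+ 3) q = q) // c3.
have [//|//|//||U3 s3_closed] := @orbit_extend c [::] p0 c3; first exact: cp0.
rewrite !cat0s in U3 s3_closed; set s3 := (X in uniq X) in U3 s3_closed.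
have [[p3 p3s cp3]|none] :=
  pselect (exists2 p3, p3 \notin s3 & c p3 != p3); last first.
  exists p0, (c p0), (c (c p0)); split=> //; apply: symP => p.
  rewrite cycle3E // /rot3.
  case: eqP => [->//|p_0]; case: eqP => [->//|p_1]; case: eqP => [->//|p_2].
  apply: contrapT => /eqP cp; apply: none; exists p => //.
  by rewrite !inE !negb_or; do 3!(apply/andP; split=> //; try exact/eqP).
have [U6 s6_closed] := orbit_extend c3 U3 s3_closed p3s cp3.
set s6 := (X in uniq X) in U6 s6_closed.
have [p6 p6s] := fresh s6.
have nth_inj s : uniq s -> {in gtn (size s) &, injective (nth p0 s)}.
  by move=> Us i j /= si sj /eqP; rewrite nth_uniq // => /eqP.
have [cp6|cp6] := eqVneq (c p6) p6.
  pose s7 := s6 ++ [:: p6].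
  have U7 : uniq s7 by rewrite cat_uniq U6 /= orbF andbT.
  have F : follows (nth p0 s7) 7 c (nth 0 [:: 1%N; 2; 0; 4; 5; 3; 6]).
    by do 7![case; first by move=> _; rewrite /= ?cK ?cp6].
  by case: (exponent30_fails (nth_inj _ U7) _ F).
have [U9 _] := orbit_extend c3 U6 s6_closed p6s cp6.
set s9 := (X in uniq X) in U9.
have F : follows (nth p0 s9) 9 c (nth 0 [:: 1%N; 2; 0; 4; 5; 3; 7; 8; 6]).
  by do 9![case; first by move=> _; rewrite /= ?cK].
by case: (exponent30_fails (nth_inj _ U9) _ F).
Qed.

End Recognition.

(** * Automorphisms are conjugations *)

Section Transport.
Variables (K : groupType) (f : UMagmaMorphism.type K K).
Hypothesis f_bij : bijective f.

(** In the groups considered below these are exactly the 3-cycles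
    ([like_cycle3P]). *)
Definition like_cycle3 (c : K) :=
  [/\ c ^+ 3 = 1, c <> 1 & forall h, (c * c ^ h) ^+ 30 = 1].

Lemma like_cycle3_bij c : like_cycle3 (f c) <-> like_cycle3 c.
Proof.
have f_inj := bij_inj f_bij; have [g fK gK] := f_bij.
rewrite /like_cycle3 -gmulfXn; split=> -[c3 c1 cJ]; split.
- by apply: f_inj; rewrite gmulf1.
- by move=> E; apply: c1; rewrite E gmulf1.
- by move=> h; apply: f_inj; rewrite gmulfXn gmulfM gmulfJ gmulf1.
- by rewrite c3 gmulf1.
- by rewrite -(@gmulf1 _ _ f) => /f_inj.
- by move=> h; rewrite -[h]gK -gmulfJ -gmulfM -gmulfXn cJ gmulf1.
Qed.

End Transport.

Lemma involutive_product_inj (K L : groupType)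
    (f : UMagmaMorphism.type K L) c d :
  injective f -> involutive_product (f c) (f d) <-> involutive_product c d.
Proof.
move=> f_inj; rewrite /involutive_product -gmulfM -gmulfXn.
by split=> -[sq ne1]; split;
  [apply: f_inj; rewrite sq gmulf1|move=> E; apply: ne1; rewrite E gmulf1
  |rewrite sq gmulf1|rewrite -(@gmulf1 _ _ f) => /f_inj].
Qed.

Section Inner.
Variable X : eqType.
Hypothesis X_inf : infinite_set [set: X].
Variable H : subgroup (Sym X).
Hypothesis H_alt : @FAlt X `<=` H.

Definition hcycle3 x y z : H :=
  exist (fun s => s \in (H : set (Sym X))) (cycle3 x y z)
    (mem_set (H_alt (cycle3_FAlt x y z))).

Lemma hcycle3E x y z : val (hcycle3 x y z) = cycle3 x y z. Proof. by []. Qed.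

Lemma hcycle3J x y z (h : H) :
  hcycle3 x y z ^ h = hcycle3 (val h x) (val h y) (val h z).
Proof. by apply: val_inj; rewrite gmulfJ /= cycle3J. Qed.

Lemma like_cycle3P (c : H) : like_cycle3 c <-> is_cycle3 (val c).
Proof.
split=> [[c3 c1 cJ]|].
  apply: (exponent30_is_cycle3 X_inf).
  - by rewrite -gmulfXn c3 gmulf1.
  - by rewrite -(gmulf1 : val (1 : H) = 1) => /val_inj.
  move=> x y z u v w; rewrite -!hcycle3E -gmulfM -gmulfJ -gmulfM -gmulfXn cJ.
  exact: gmulf1.
move=> c3; split.
- by apply: val_inj; rewrite gmulfXn is_cycle3_cube // gmulf1.
- by move=> E; apply: (is_cycle3_neq1 c3); rewrite E gmulf1.
move=> h; apply: val_inj; rewrite gmulf1.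
have -> : val ((c * c ^ h) ^+ 30) = (val c * val c ^ val h) ^+ 30.
  by rewrite gmulfXn gmulfM gmulfJ.
have [x [y [z [U ->]]]] := c3; rewrite cycle3J cycle3_prod_order //.
rewrite -[[:: _; _; _]]/(map (val h) [:: x; y; z]) map_inj_uniq //.
exact: can_inj (symKV _).
Qed.

Variable phi : UMagmaMorphism.type H H.
Hypothesis phi_bij : bijective phi.

Lemma val_phiJ x y : val (phi (x ^ y)) = val (phi x) ^ val (phi y).
Proof. by rewrite !gmulfJ. Qed.

Lemma phi_is_cycle3 (c : H) : is_cycle3 (val (phi c)) <-> is_cycle3 (val c).
Proof.
by split=> /like_cycle3P c3; apply/like_cycle3P/(like_cycle3_bij phi_bij).
Qed.

Lemma phi_involutive (c d : H) :
  involutive_product (val (phi c)) (val (phi d)) <->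
  involutive_product (val c) (val d).
Proof.
rewrite (involutive_product_inj (f := val)); last exact: val_inj.
rewrite (involutive_product_inj (f := phi)); last exact: bij_inj phi_bij.
by rewrite (involutive_product_inj (f := val)); last exact: val_inj.
Qed.

Lemma phi_degenerate (rho : Sym X) x y z : ~~ uniq [:: x; y; z] ->
  val (phi (hcycle3 x y z)) = cycle3 (rho x) (rho y) (rho z).
Proof.
move=> nU; have -> : hcycle3 x y z = 1.
  by apply: val_inj; rewrite gmulf1 hcycle3E cycle3_degenerate.
rewrite cycle3_degenerate ?gmulf1 //.
rewrite -[[:: _; _; _]]/(map rho [:: x; y; z]) map_inj_uniq //.
exact: can_inj (symKV rho).
Qed.

(** The images of the 3-cycles (a b z) have pairwise products of order 2, so
    they all share an oriented edge p -> q; rho sends a to p, b to q and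
    z to the third point. The same argument for the inverse of [phi] makes rho
    surjective. *)
Lemma automorphism_base : exists (rho : Sym X) (a b : X), a != b /\
  forall z, val (phi (hcycle3 a b z)) = cycle3 (rho a) (rho b) (rho z).
Proof.
have [a _] := fresh X_inf [::].
have [b] := fresh X_inf [:: a]; rewrite inE => ba.
have [z1] := fresh X_inf [:: a; b]; rewrite !inE negb_or => /andP[z1a z1b].
have [z2] := fresh X_inf [:: a; b; z1].
rewrite !inE !negb_or => /and3P[z2a z2b z2z1].
have Uab z : z != a -> z != b -> uniq [:: a; b; z].
  by move=> za zb; rewrite /= !inE negb_or ![_ == z]eq_sym eq_sym ba za zb.
have Uab4 z z' : z != a -> z != b -> z' != a -> z' != b -> z != z' ->
    uniq [:: a; b; z; z'].
  move=> za zb z'a z'b zz'; rewrite /= !inE !negb_or eq_sym ba.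
  by rewrite ![_ == z']eq_sym ![_ == z]eq_sym za zb z'a z'b zz'.
pose im z := val (phi (hcycle3 a b z)).
have im3 z : z != a -> z != b -> is_cycle3 (im z).
  move=> za zb; apply/phi_is_cycle3; exists a, b, z; split=> //; exact: Uab.
have im_inv z z' : z != a -> z != b -> z' != a -> z' != b -> z != z' ->
    involutive_product (im z) (im z').
  by move=> *; apply/phi_involutive; apply: cycle3_edge_involutive; exact: Uab4.
have [//|p [im1p im2p im2q]] :=
  cycle3_common_edge (im3 z1 z1a z1b) (im3 z2 z2a z2b).
  by apply: im_inv; rewrite // eq_sym.
set q := im z1 p in im1p im2p im2q.
have imp z : z != a -> z != b -> im z p = q.
  move=> za zb; have [->//|zz1] := eqVneq z z1; have [->//|zz2] := eqVneq z z2.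
  apply: (cycle3_edge_determined _ _ _ _ im2p im2q) => //; try exact: im3;
    by apply: im_inv; rewrite // eq_sym.
have qp : q != p by apply/eqP.
have imE z : z != a -> z != b ->
    uniq [:: p; q; im z q] /\ im z = cycle3 p q (im z q).
  move=> za zb; have [] := @is_cycle3_at _ (im z) p (im3 z za zb).
    by rewrite imp //; exact/eqP.
  by rewrite imp.
pose rho x := if x == a then p else if x == b then q else im x q.
have rho_a : rho a = p by rewrite /rho eqxx.
have rho_b : rho b = q by rewrite /rho (negPf ba) eqxx.
have rhoE z : z != a -> z != b ->
    uniq [:: p; q; rho z] /\ im z = cycle3 p q (rho z).
  by move=> za zb; rewrite /rho (negPf za) (negPf zb); exact: imE.
have rho_neq z : z != a -> z != b ->
    (rho z == p = false) /\ (rho z == q = false).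
  move=> za zb; have [] := rhoE z za zb.
  rewrite /= !inE negb_or ![_ == rho z]eq_sym.
  by move=> /and3P[/andP[_ /negPf->] /negPf->].
have rho_inj : injective rho.
  have main x y : x != a -> x != b -> y != a -> y != b ->
      rho x = rho y -> x = y.
    move=> xa xb ya yb E.
    have [_ Ex] := rhoE x xa xb; have [_ Ey] := rhoE y ya yb.
    have : im x = im y by rewrite Ex Ey E.
    move=> /val_inj /(bij_inj phi_bij) /(congr1 val).
    move=> /(congr1 (fun s : Sym X => s b)).
    rewrite !hcycle3E !cycle3E; try exact: Uab.
    by rewrite /rot3 eqxx (negPf ba).
  move=> x y; case: (eqVneq x a) => [->|xa]; case: (eqVneq y a) => [->//|ya].
  - rewrite rho_a; case: (eqVneq y b) => [->|yb].
      by rewrite rho_b => /eqP; rewrite eq_sym (negPf qp).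
    by move/esym/eqP; rewrite (rho_neq y ya yb).1.
  - rewrite rho_a; case: (eqVneq x b) => [->|xb].
      by rewrite rho_b => /eqP; rewrite (negPf qp).
    by move/eqP; rewrite (rho_neq x xa xb).1.
  case: (eqVneq x b) => [->|xb]; case: (eqVneq y b) => [->//|yb].
  - by rewrite rho_b => /esym/eqP; rewrite (rho_neq y ya yb).2.
  - by rewrite rho_b => /eqP; rewrite (rho_neq x xa xb).2.
  exact: main.
have rho_surj t : exists x, rho x = t.
  case: (eqVneq t p) => [->|tp]; first by exists a.
  case: (eqVneq t q) => [->|tq]; first by exists b.
  case: (eqVneq t (rho z1)) => [->|t1]; first by exists z1.
  case: (eqVneq t (rho z2)) => [->|t2]; first by exists z2.
  have [g phiK gK] := phi_bij; pose f := g (hcycle3 p q t).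
  have phif : val (phi f) = cycle3 p q t by rewrite gK.
  have Upqt : uniq [:: p; q; t].
    by rewrite /= !inE negb_or ![_ == t]eq_sym eq_sym qp tp tq.
  have f3 : is_cycle3 (val f).
    by apply/phi_is_cycle3; rewrite phif; exists p, q, t.
  have f_inv z : z != a -> z != b -> t != rho z ->
      involutive_product (cycle3 a b z) (val f).
    move=> za zb tz; apply/(phi_involutive (hcycle3 a b z)); rewrite phif.
    have [U E] := rhoE z za zb; rewrite -/(im z) E.
    apply: cycle3_edge_involutive.
    move: U Upqt; rewrite /= !inE !negb_or !andbT.
    by move=> /andP[/andP[-> ->] ->] /andP[/andP[_ ->] ->]; rewrite eq_sym.
  have at_a z : z != a -> z != b -> cycle3 a b z a = b /\ cycle3 a b z b = z.
    move=> za zb; rewrite !cycle3E; try exact: Uab.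
    by rewrite /rot3 !eqxx (negPf ba).
  have [c1a c1b] := at_a z1 z1a z1b; have [c2a c2b] := at_a z2 z2a z2b.
  have fa : val f a = b.
    rewrite -c1a.
    apply: (@cycle3_edge_determined _ (cycle3 a b z1) (cycle3 a b z2)).
    + by exists a, b, z1; split=> //; exact: Uab.
    + by exists a, b, z2; split=> //; exact: Uab.
    + exact: f3.
    + by rewrite c1a; exact/eqP.
    + by rewrite c1a c2a.
    + by rewrite c1a c1b c2b; exact/eqP.
    + exact: f_inv.
    + exact: f_inv.
  have [|Uf Ef] := is_cycle3_at (p := a) f3; first by rewrite fa; exact/eqP.
  rewrite fa in Uf Ef; set z := val f b in Uf Ef.
  have [za zb] : z != a /\ z != b.
    move: Uf; rewrite /= !inE negb_or ![_ == z]eq_sym.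
    by move=> /and3P[/andP[_ ->] ->].
  exists z; have [U E] := rhoE z za zb.
  have : im z = cycle3 p q t.
    by rewrite -phif /im; congr (val (phi _)); apply: val_inj; rewrite Ef.
  move=> /(congr1 (fun s : Sym X => s q)); rewrite E !cycle3E //.
  by rewrite /rot3 eqxx (negPf qp).
have [rho' rho'K] := choice rho_surj.
pose Rho : Sym X := MkSym (inj_can_sym rho'K rho_inj) rho'K.
exists Rho, a, b; split; first by rewrite eq_sym.
move=> z; case: (boolP (uniq [:: a; b; z])) => U; last exact: phi_degenerate.
have [za zb] : z != a /\ z != b.
  by move: U; rewrite /= !inE negb_or ![_ == z]eq_sym => /and3P[/andP[_ ->] ->].
by rewrite /= rho_a rho_b; have [] := rhoE z za zb.
Qed.

(** The triples on which [phi] acts as conjugation by rho are stable under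
    rotation, reversal and under the 3-cycles of such triples, and these
    operations lead from the triples (a, b, z) to all others. *)
Lemma automorphism_cycle3 : exists rho : Sym X, forall x y z,
  val (phi (hcycle3 x y z)) = cycle3 (rho x) (rho y) (rho z).
Proof.
have [rho [a [b [ab Pab]]]] := automorphism_base.
exists rho.
pose P x y z := val (phi (hcycle3 x y z)) = cycle3 (rho x) (rho y) (rho z).
have rot x y z : P x y z -> P y z x.
  rewrite /P -(cycle3_rot (rho x)) => <-.
  by congr (val (phi _)); apply: val_inj; rewrite /= -cycle3_rot.
have rev x y z : P x y z -> P y x z.
  rewrite /P -(cycle3V (rho x)) => <-.
  rewrite -gmulfV -gmulfV; congr (val (phi _)).
  by apply: val_inj; rewrite gmulfV /= cycle3V.
have conj x y z u v w : P x y z -> P u v w ->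
    P (cycle3 u v w x) (cycle3 u v w y) (cycle3 u v w z).
  rewrite /P => Pxyz Puvw; rewrite -hcycle3E -hcycle3J val_phiJ Pxyz Puvw.
  rewrite cycle3J.
  have E p : cycle3 (rho u) (rho v) (rho w) (rho p) = rho (cycle3 u v w p).
    by rewrite -cycle3J symJ.
  by rewrite !E.
have Uout w : w != a -> w != b -> uniq [:: a; b; w] /\ uniq [:: b; a; w].
  move=> wa wb; rewrite /= !inE !negb_or [b == a]eq_sym ab.
  by rewrite ![_ == w]eq_sym wa wb.
(* (a b w) moves (a b z) to (b w z), and its inverse moves it to (w a z). *)
have step1 w z : w != a -> w != b -> z != a -> z != b -> w != z ->
    P b w z /\ P a z w.
  move=> wa wb za zb wz; have [Uabw Ubaw] := Uout w wa wb; split.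
    have := conj _ _ _ _ _ _ (Pab z) (Pab w).
    rewrite !(cycle3E Uabw).
    rewrite /rot3 eqxx [b == a]eq_sym (negPf ab) eqxx (negPf za) (negPf zb).
    by rewrite eq_sym (negPf wz).
  have := conj _ _ _ _ _ _ (Pab z) (rev _ _ _ (Pab w)).
  rewrite !(cycle3E Ubaw).
  rewrite /rot3 eqxx (negPf ab) eqxx (negPf za) (negPf zb) eq_sym (negPf wz).
  by move=> /rot.
(* The inverse of (a b u) moves (a w z) to (u w z). *)
have step2 u w z : u != a -> u != b -> w != a -> w != b -> z != a -> z != b ->
    uniq [:: u; w; z] -> P u w z.
  move=> ua ub wa wb za zb; rewrite /= !inE negb_or andbT.
  move=> /andP[/andP[uw uz] wz].
  have Pazw := (step1 z w za zb wa wb); rewrite eq_sym in Pazw.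
  have := conj _ _ _ _ _ _ (proj2 (Pazw wz)) (rev _ _ _ (Pab u)).
  rewrite !(cycle3E (proj2 (Uout u ua ub))).
  rewrite /rot3 eqxx (negPf ab) (negPf wa) (negPf wb) (negPf za) (negPf zb).
  by rewrite ![_ == u]eq_sym (negPf uw) (negPf uz).
move=> x y z; rewrite -/(P x y z).
case: (boolP (uniq [:: x; y; z])) => U; last exact: phi_degenerate.
move: (U); rewrite /= !inE negb_or andbT => /andP[/andP[xy xz] yz].
have [?|xa] := eqVneq x a; [subst x|have [?|xb] := eqVneq x b; [subst x|]].
- have [?|yb] := eqVneq y b; first by subst y; exact: Pab.
  have [?|zb] := eqVneq z b; first by subst z; apply/rot/rev; exact: Pab.
  by apply: (proj2 (step1 z y _ _ _ _ _)); rewrite // eq_sym.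
- have [?|ya] := eqVneq y a; first by subst y; apply/rev; exact: Pab.
  have [?|za] := eqVneq z a; first by subst z; apply: rot; exact: Pab.
  by apply: (proj1 (step1 y z _ _ _ _ _)); rewrite // eq_sym.
have [?|ya] := eqVneq y a; [subst y|have [?|yb] := eqVneq y b; [subst y|]].
- have [?|zb] := eqVneq z b; first by subst z; apply/rot/rot; exact: Pab.
  by apply/rot/rot; apply: (proj2 (step1 x z _ _ _ _ _)); rewrite // eq_sym.
- have [?|za] := eqVneq z a.
    by subst z; apply/rot/rot; apply: rev; exact: Pab.
  by apply/rot/rot; apply: (proj1 (step1 z x _ _ _ _ _)); rewrite // eq_sym.
have [?|za] := eqVneq z a; [subst z|have [?|zb] := eqVneq z b; [subst z|]].
- by apply: rot; apply: (proj2 (step1 y x _ _ _ _ _)); rewrite // eq_sym.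
- by apply: rot; apply: (proj1 (step1 x y _ _ _ _ _)); rewrite // eq_sym.
exact: step2.
Qed.

(** Both h rho and rho phi(h) carry the 3-cycles in the same way, and a
    permutation of an infinite set is determined by its action on them. *)
Lemma automorphism_inner :
  exists rho : Sym X, forall h : H, val (phi h) = val h ^ rho.
Proof.
have [rho Prho] := automorphism_cycle3; exists rho => h.
pose u : Sym X := val h * rho; pose v : Sym X := rho * val (phi h).
have uv x y z : cycle3 (u x) (u y) (u z) = cycle3 (v x) (v y) (v z).
  by rewrite !symM -Prho -hcycle3J val_phiJ Prho cycle3J.
suff E : u = v by rewrite conjgE -[val h * rho]/u E /v mulKg.
apply: symP => x; apply/eqP; apply: contraT => ne.
(* y and z are chosen so that (v x, v y, v z) fixes u x. *)
have [y] := fresh X_inf [:: x; (v^-1 : Sym X) (u x)].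
rewrite !inE negb_or => /andP[yx yv].
have [z] := fresh X_inf [:: x; (v^-1 : Sym X) (u x); y].
rewrite !inE !negb_or => /and3P[zx zv zy].
have Uu : uniq [:: u x; u y; u z].
  rewrite -[[:: _; _; _]]/(map u [:: x; y; z]) map_inj_uniq.
    by rewrite /= !inE negb_or ![x == _]eq_sym yx zx eq_sym zy.
  exact: can_inj (symKV u).
have Uv : uniq [:: v x; v y; v z].
  rewrite -[[:: _; _; _]]/(map v [:: x; y; z]) map_inj_uniq.
    by rewrite /= !inE negb_or ![x == _]eq_sym yx zx eq_sym zy.
  exact: can_inj (symKV v).
have := congr1 (fun s : Sym X => s (u x)) (uv x y z).
have not_v w : w != (v^-1 : Sym X) (u x) -> (u x == v w) = false.
  by apply: contraNF => /eqP ->; rewrite symKV.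
rewrite !cycle3E // /rot3 eqxx (negPf ne) !not_v // => E.
by move: Uu; rewrite E /= inE eqxx.
Qed.

End Inner.

(** * Supports of the elements of a coset *)

Section SupportChains.
Variable X : eqType.
Implicit Types s t c : Sym X.

(** [x] maps the support of [s] onto that of [s ^ x]. If the latter lies in the
    former, all forward iterates under [x] of a point moved by [s] are moved
    by [s ^ x], and the point itself is one of them. *)
Lemma support_conj_sub s (x : Sym X) :
    (forall p, exists k, iter k.+1 x p = p) ->
  Defs.support (s ^ x) `<=` Defs.support s ->
  Defs.support s `<=` Defs.support (s ^ x).
Proof.
move=> x_cycles sub w sw.
have step p : Defs.support s p -> Defs.support (s ^ x) (x p).
  by move=> sp E; apply: sp; apply: (can_inj (symKV x)); rewrite -symJ.
have sk k : Defs.support s (iter k x w) by elim: k => // k IHk; exact/sub/step.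
have [k Ek] := x_cycles w; rewrite -Ek iterS; exact/step/sk.
Qed.

Lemma support_mul_finite s c : finite_set (Defs.support c) -> exists2 F : set X,
  finite_set F & forall p, ~ F p -> (s * c) p = s p.
Proof.
move=> c_fin; exists ((s^-1)%g @` Defs.support c); first exact: finite_image.
move=> p Fp; rewrite symM; apply: contrapT => cp; apply: Fp.
by exists (s p) => //; rewrite symKV.
Qed.

Lemma infinite_almost_sub T (A B F : set T) : finite_set F -> A `<=` B `|` F ->
  infinite_set A -> infinite_set B.
Proof.
move=> F_fin AB A_inf B_fin; apply: A_inf; apply: sub_finite_set AB _.
by rewrite finite_setU.
Qed.

(** Following [s] by the 3-cycle y -> x -> z -> y with y = s x makes x fixed,
    and disturbs no fixed point because x, y, z are all moved by [s]. *)
Lemma support_shrink s : infinite_set (Defs.support s) -> exists x y z,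
  Defs.support (s * cycle3 x y z) `<` Defs.support s /\
  infinite_set (Defs.support (s * cycle3 x y z)).
Proof.
move=> s_inf; have [x sx _] := infinite_avoid [::] s_inf.
have s_inj := can_inj (symKV s).
have ssx : s (s x) <> s x by move=> /s_inj.
have [z sz] := infinite_avoid [:: x; s x] s_inf.
rewrite !inE negb_or => /andP[zx zy].
exists (s x), x, z.
have U : uniq [:: s x; x; z].
  by rewrite /= !inE negb_or ![_ == z]eq_sym zx zy !andbT; exact/eqP.
split; last first.
  have [F F_fin FE] := support_mul_finite s (cycle3_FAlt (s x) x z).1.
  apply: infinite_almost_sub F_fin _ s_inf => p sp.
  have [Fp|Fp] := pselect (F p); [by right|left].
  by rewrite /Defs.support /mkset FE.
split=> [p scp sp|]; last first.
  by move=> /(_ x sx); apply; rewrite symM cycle3E // /rot3 eqxx.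
apply: scp; rewrite symM sp cycle3E // /rot3.
case: eqP => [E|_]; first by case: ssx; rewrite -E.
case: eqP => [E|_]; first by case: sx; rewrite -E.
by case: eqP => [E|_] //; case: sz; rewrite -E.
Qed.

Lemma support_grow s : infinite_set (~` Defs.support s) -> exists x y z,
  Defs.support s `<` Defs.support (s * cycle3 x y z) /\
  infinite_set (~` Defs.support (s * cycle3 x y z)).
Proof.
move=> s_inf; have s_inj := can_inj (symKV s).
have [x /contrapT sx _] := infinite_avoid [::] s_inf.
have [y /contrapT sy] := infinite_avoid [:: x] s_inf; rewrite inE => yx.
have [z /contrapT sz] := infinite_avoid [:: x; y] s_inf.
rewrite !inE negb_or => /andP[zx zy].
exists x, y, z.
have U : uniq [:: x; y; z].
  by rewrite /= !inE negb_or ![_ == z]eq_sym zx zy eq_sym yx.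
split; last first.
  have [F F_fin FE] := support_mul_finite s (cycle3_FAlt x y z).1.
  apply: infinite_almost_sub F_fin _ s_inf => p sp.
  have [Fp|Fp] := pselect (F p); [by right|left].
  by rewrite /setC /Defs.support /mkset FE.
split=> [p sp|].
  rewrite /Defs.support /mkset symM cycle3E // /rot3.
  have nfix q : s q = q -> s p <> q.
    by move=> sq spq; apply: sp; rewrite spq; apply: s_inj; rewrite sq spq.
  case: eqP => [/nfix|_]; first by case.
  case: eqP => [/nfix|_]; first by case.
  by case: eqP => [/nfix|_]; first by case.
move=> /(_ x); apply; last exact: sx.
rewrite /Defs.support /mkset symM sx cycle3E // /rot3 eqxx; exact/eqP.
Qed.

End SupportChains.

(** * Twisted classes in groups whose elements have finite cycles *)

Lemma exists_monotone_seq (K : Type) (Q : K -> Prop) (R : K -> K -> Prop) a0 :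
    Q a0 -> (forall a, Q a -> exists b, R a b /\ Q b) ->
    (forall b a c, R a b -> R b c -> R a c) ->
  exists u : nat -> K, forall m n, m < n -> R (u m) (u n).
Proof.
move=> Qa0 step R_trans.
have /choice[f Qf] : forall a, exists b, Q a -> R a b /\ Q b.
  move=> a; have [/step[b Rb]|nQa] := pselect (Q a); first by exists b.
  by exists a.
exists (fun n => iter n f a0).
have Qu n : Q (iter n f a0) by elim: n => //= n /Qf[].
apply: homo_ltn => [b a c|n]; first exact: R_trans.
by rewrite iterS; have [] := Qf _ (Qu n).
Qed.

Lemma infinite_of_nat_inj (T : Type) (u : nat -> T) (A : set T) :
  (forall n, A (u n)) -> (forall m n, m < n -> u m <> u n) -> infinite_set A.
Proof.
move=> Au u_neq A_fin; apply: infinite_nat.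
have u_inj : injective u.
  move=> m n E; apply/eqP; case: ltngtP => // /u_neq; by rewrite E.
have <- := @eq_finite_set _ _ (u @` [set: nat]) [set: nat].
  by apply: sub_finite_set A_fin => _ [n _ <-].
by apply: inj_card_eq => m n _ _; exact: u_inj.
Qed.

Section Main.
Variable X : eqType.
Hypothesis X_inf : infinite_set [set: X].
Variable H : subgroup (Sym X).
Hypothesis H_alt : @FAlt X `<=` H.
Hypothesis H_cycles :
  forall (h : H) p, exists k, iter k.+1 (val h : Sym X) p = p.

(** When [x] witnesses that [a] and [b] are twisted conjugate, [rho * b] is the
    conjugate of [rho * a] by [x]; so twisted conjugate elements never have
    strictly nested supports. *)
Theorem R_infinity_of_finite_cycles : R_infinity H.
Proof.
move=> phi0 phi0_bij.
have phi0_1 : phi0 1 = 1 by apply: (mulgI (phi0 1)); rewrite -gmulfM !mulg1.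
(* The theory of inverses, powers and conjugates needs phi0 1 = 1. *)
pose phi : UMagmaMorphism.type H H := HB.pack (phi0 : H -> H)
  (isMultiplicative.Build _ _ (phi0 : H -> H) gmulfM)
  (Multiplicative_isUMagmaMorphism.Build _ _ (phi0 : H -> H) phi0_1).
have [rho phiE] := automorphism_inner X_inf H_alt (phi := phi) phi0_bij.
pose S (a : H) := Defs.support (rho * val a).
have twisted_conjE a b : twisted_conj phi0 a b ->
    exists x : H, rho * val b = (rho * val a) ^ val x.
  move=> [x <-]; exists x.
  have -> : val (phi0 x^-1 * a * x) = val (phi x^-1) * val a * val x by [].
  by rewrite phiE gmulfV !conjgE !mulgA mulgV mul1g.
have class_neq a b : S b `<` S a ->
    twisted_class phi0 a <> twisted_class phi0 b.
  move=> [Sba nSab] E.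
  have /twisted_conjE[x Ex] : twisted_conj phi0 a b.
    have : twisted_class phi0 b b by exists 1; rewrite mulg1 invg1 phi0_1 mul1g.
    by rewrite -E.
  apply: nSab; rewrite /S Ex; apply: support_conj_sub (H_cycles x) _.
  by rewrite -Ex.
have mulS a x y z : S (a * hcycle3 H_alt x y z) =
    Defs.support (rho * val a * cycle3 x y z).
  by rewrite /S -mulgA.
have proper_trans (A B C : set X) : A `<` B -> B `<` C -> A `<` C.
  move=> [AB _] [BC nCB]; split; first exact: subset_trans AB BC.
  by move=> CA; apply: nCB; exact: subset_trans CA AB.
have [S_inf|S_fin] := pselect (infinite_set (S 1)).
  have [|b a c Rab Rbc|u Ru] := @exists_monotone_seq H
      (fun a => infinite_set (S a)) (fun a b => S b `<` S a) 1 S_inf.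
  - move=> a /support_shrink[x [y [z [sub inf]]]].
    by exists (a * hcycle3 H_alt x y z); rewrite mulS.
  - exact: proper_trans Rbc Rab.
  apply: (@infinite_of_nat_inj _ (fun n => twisted_class phi0 (u n))).
    by move=> n; exists (u n).
  by move=> m n mn; exact/class_neq/Ru.
have S_cofin : infinite_set (~` S 1).
  move=> S_cofin; apply: X_inf.
  by rewrite -(setUv (S 1)) finite_setU; split=> //; exact: contrapT.
have [|b a c Rab Rbc|u Ru] := @exists_monotone_seq H
    (fun a => infinite_set (~` S a)) (fun a b => S a `<` S b) 1 S_cofin.
- move=> a /support_grow[x [y [z [sub inf]]]].
  by exists (a * hcycle3 H_alt x y z); rewrite mulS.
- exact: proper_trans Rab Rbc.
apply: (@infinite_of_nat_inj _ (fun n => twisted_class phi0 (u n))).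
  by move=> n; exists (u n).
by move=> m n mn E; apply: (class_neq _ _ (Ru m n mn)); rewrite E.
Qed.

End Main.

(** * The disjoint union of the finite quotients *)

Section Blocks.
Variable G : groupType.
Local Notation Q := (quotients_union G).

(** Outside the blocks indexed by [S] the block of a point is kept. The second
    alternative is symmetric in [p] and [s p], which makes the condition stable
    under inverses and under enlarging [S]. *)
Definition preserves_other_blocks (s : Sym Q) (S : set (fin_index_normal G)) :=
  forall p, projT1 (s p) = projT1 p \/ (S (projT1 p) /\ S (projT1 (s p))).

Definition almost_preserves_blocks : set (Sym Q) :=
  [set s | exists2 S, finite_set S & preserves_other_blocks s S].

Lemma almost_preserves_blocks_closed :
  group_closed (mem almost_preserves_blocks).
Proof.
split; first by apply/mem_set; exists set0 => // p; left.
move=> s t /set_mem[S S_fin sS] /set_mem[T T_fin tT]; apply/mem_set.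
exists (S `|` T); first by rewrite finite_setU.
move=> p; pose q := s p; pose r := (t^-1)%g q.
change (projT1 r = projT1 p \/ (S `|` T) (projT1 p) /\ (S `|` T) (projT1 r)).
have := tT r; rewrite (symVK t q : t r = q) => tr.
have := sS p; rewrite -/q => sp.
case: tr sp => [<-|[Tr Tq]] [E|[Sp Sq]]; rewrite ?E /setU /=;
  try by [left|tauto].
by rewrite E in Tq; tauto.
Qed.

Lemma projT1_rmul g (p : Q) : projT1 (rmul g p) = projT1 p.
Proof. by case: p. Qed.

Lemma gen_almost_preserves_blocks :
  subgroup_gen (range (@right_action G) `|` @FAlt Q) `<=`
  almost_preserves_blocks.
Proof.
apply: smallest_sub; first exact: almost_preserves_blocks_closed.
move=> s [[g _ <-]|[s_fin _]].
  by exists set0 => // p; left; exact: projT1_rmul.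
exists ((fun p => projT1 p) @` Defs.support s); first exact: finite_image.
move=> p; have [->|sp] := pselect (s p = p); [by left|right].
split; first by exists p.
by exists (s p) => //; move=> /(can_inj (symKV s)).
Qed.

Lemma finite_blocks (S : set (fin_index_normal G)) :
  finite_set S -> finite_set [set p : Q | S (projT1 p)].
Proof.
move=> S_fin.
have -> : [set p : Q | S (projT1 p)] =
    \bigcup_(N in S) [set p : Q | projT1 p = N].
  by apply/seteqP; split=> [p Sp|p [N SN /= ->//]]; exists (projT1 p).
apply: bigcup_finite => // N _.
pose f (p : Q) : set G := val (projT2 p).
have f_inj : {in [set p : Q | projT1 p = N] &, injective f}.
  move=> [M C] [M' C'] /set_mem /= MN /set_mem /= M'N; subst M M'.
  by move=> E; congr existT; exact: val_inj E.
have <- := eq_finite_set (inj_card_eq f_inj).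
apply: sub_finite_set (proj2 (proj2_sig N)) => _ [p <- <-].
exact: set_mem (valP (projT2 p)).
Qed.

(** The blocks in [S] together with the block of [p] form a finite set of points
    that is stable under [s]. *)
Lemma finite_cycles s p :
  almost_preserves_blocks s -> exists k, iter k.+1 s p = p.
Proof.
move=> [S S_fin sS]; pose B := [set q : Q | (S `|` [set projT1 p]) (projT1 q)].
have B_fin : finite_set B by apply: finite_blocks; rewrite finite_setU.
have B_s q : B q -> B (s q).
  by rewrite /B /=; case: (sS q) => [->//|[_ ?] _]; left.
have Bk k : B (iter k s p) by elim: k => [|k]; [right|exact: B_s].
apply: contrapT => /forallNP none; apply: (infinite_of_nat_inj Bk) B_fin.
move=> m n mn E; apply: (none (n - m.+1)%N).
elim: m n mn E => [|m IHm] [|n] // mn E; first by rewrite subn1.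
by rewrite subSS; apply: IHm => //; exact: (can_inj (symKV s)).
Qed.

(** Otherwise G would embed into the finite set of maps from the union to
    itself. *)
Lemma infinite_quotients_union :
  infinite_set [set: G] -> residually_finite G -> infinite_set [set: Q].
Proof.
move=> G_inf G_rf Q_fin; apply: G_inf.
pose T : choiceType := {classic Q}.
have [s sE] := (@finite_seqP T [set: Q]).1 Q_fin.
have all_s (p : T) : p \in s by have : [set: Q] p by []; rewrite sE.
pose F (g : G) : {ffun @seq_sub T s -> @seq_sub T s} :=
     [ffun p : @seq_sub T s => SeqSub (all_s (rmul g (ssval p : T)))].
have F_inj : injective F.
  move=> g h /ffunP E; apply: (right_action_inj G_rf); apply: symP => p.
  by have /(congr1 val) := E (SeqSub (all_s p)); rewrite !ffunE.
have /eq_finite_set <- : (F @` [set: G] #= [set: G])%card.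
  by apply: inj_card_eq => g h _ _; exact: F_inj.
exact: finite_finset.
Qed.

End Blocks.

Theorem corollary3p15 (G : groupType) :
  infinite_set [set: G] -> residually_finite G ->
  R_infinity (subgroup_gen (range (@right_action G)
                         `|` @FAlt (quotients_union G))).
Proof.
move=> G_inf G_rf.
apply: (@R_infinity_of_finite_cycles {classic (quotients_union G)}).
- exact: infinite_quotients_union.
- by apply: subset_trans (@sub_gen_smallest _ _ _) => s; right.
move=> h p; apply/finite_cycles/gen_almost_preserves_blocks.
exact: set_mem (valP h).
Qed.
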